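(* Let $f,g,h,k$ be smooth real functions on a real interval $I$ with $h(y)\neq 0$ for all $y\in I$. Consider the quadratic-cubic extended Liénard equation for $y=y(x)$, $$y''+f(y)(y')^2+k(y)(y')^3+g(y)y'+h(y)=0,$$ and its associated Abel equation for $v=v(y)$ (with $v=1/y'$), $$\frac{dv}{dy}=k(y)+f(y)v+g(y)v^2+h(y)v^3.$$ Suppose that the Abel equation has the particular solution $v_{p0}(y)=-\dfrac{g(y)}{3h(y)}$, and that the coefficients satisfy $$\frac{d}{dy}\left[\frac{g(y)}{h(y)}\right]=-3k(y)+\frac{f(y)g(y)}{h(y)}-\frac{2}{9}\frac{g^3(y)}{h^2(y)}.$$ Then the general solution of the quadratic-cubic extended Liénard equation is given by $$x-x_0=\int\left\{\pm\frac{e^{\int\left[f(y)-g^2(y)/(3h(y))\right]dy}}{\sqrt{2}\,\sqrt{C-\int h(y)\,e^{2\int\left[f(y)-g^2(y)/(3h(y))\right]dy}\,dy}}-\frac{g(y)}{3h(y)}\right\}dy,$$ where $C$ and $x_0$ are arbitrary constants of integration.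
   Context: Primes denote derivatives with respect to $x$. The symbol $\int(\cdot)\,dy$ denotes a fixed antiderivative with respect to $y$; the same antiderivative of $f-g^2/(3h)$ is used in both places where it occurs. ''General solution'' is meant in the classical sense: a family of solutions depending on as many arbitrary constants as the order of the equation, on domains where all expressions are defined (here $C-\int h\,e^{2\int[\cdots]dy}dy>0$). A relation $x-x_0=\int v(y)\,dy$ describes a solution $y(x)$ implicitly, with $y'=1/v(y)$ where $v\neq 0$. *)

(* Defs.v *)
From Stdlib Require Import Reals.
From Coquelicot Require Import Coquelicot.
Open Scope R_scope.

(* Intervals of any kind (open, closed, half-open, unbounded), except that
   the empty set and single points are excluded. *)
Definition interval (I : R -> Prop) : Prop :=
  (exists a b, I a /\ I b /\ a < b) /\
  (forall a b c, I a -> I b -> a <= c <= b -> I c).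

(* Derivative relative to [D]: the usual one at interior points of [D], the
   one-sided one at an endpoint belonging to [D].  Values of [u] outside [D]
   play no role when [D x]. *)
Definition is_derive_on (D : R -> Prop) (u : R -> R) (x l : R) : Prop :=
  filterdiff u (within D (locally x)) (fun t => scal t l).

Definition antiderivative_on (D : R -> Prop) (u U : R -> R) : Prop :=
  forall x, D x -> is_derive_on D U x (u x).

(* [d n] is the n-th derivative of [u] on [D]. *)
Definition smooth_on (D : R -> Prop) (u : R -> R) : Prop :=
  exists d : nat -> R -> R,
    (forall x, D x -> d 0%nat x = u x) /\
    (forall n, antiderivative_on D (d (S n)) (d n)).

Definition lienard_solution (I : R -> Prop) (f g h k : R -> R)
    (J : R -> Prop) (y : R -> R) : Prop :=
  exists y1 y2 : R -> R, forall x, J x ->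
    I (y x) /\ is_derive_on J y x (y1 x) /\ is_derive_on J y1 x (y2 x) /\
    y2 x + f (y x) * y1 x ^ 2 + k (y x) * y1 x ^ 3 + g (y x) * y1 x + h (y x)
      = 0.

Definition abel_solution (I : R -> Prop) (f g h k : R -> R) (v : R -> R)
    : Prop :=
  forall y, I y ->
    is_derive_on I v y (k y + f y * v y + g y * v y ^ 2 + h y * v y ^ 3).

Definition v_p0 (g h : R -> R) (y : R) : R := - (g y / (3 * h y)).

Definition pm (s : bool) : R := if s then 1 else -1.

(* [A] is the antiderivative of f - g^2/(3h) and [B] that of h e^(2A). *)
Definition v_gen (g h A B : R -> R) (s : bool) (C y : R) : R :=
  pm s * (exp (A y) / (sqrt 2 * sqrt (C - B y))) - g y / (3 * h y).

Definition v_gen_domain (I : R -> Prop) (B : R -> R) (C y : R) : Prop :=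
  I y /\ C - B y > 0.

(* [y] is a continuous branch over [J] of the curve x - x0 = Phi s C (y), where
   [Phi s C] is an antiderivative of [v_gen g h A B s C].  Continuity keeps [y]
   on one branch, since [Phi s C] need not be injective; v <> 0 is what makes
   the relation define a function of x with y' = 1 / v(y). *)
Definition implicit_curve (I : R -> Prop) (g h A B : R -> R)
    (Phi : bool -> R -> R -> R) (s : bool) (C x0 : R)
    (J : R -> Prop) (y : R -> R) : Prop :=
  continuous_on J y /\
  forall x, J x ->
    v_gen_domain I B C (y x) /\ v_gen g h A B s C (y x) <> 0 /\
    x - x0 = Phi s C (y x).

(* The family of curves x - x0 = Phi s C (y), with constants [C] and [x0] and a
   choice of sign [s], is the general solution of the equation:
   - its members are solutions, with y' = 1 / v(y);
   - for every choice of the constants there is a member running through any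
     interval [E] on which the expressions are defined and v <> 0;
   - the constants are essential: distinct choices give distinct members;
   - every solution for which v = 1 / y' makes sense is a member, apart from
     those with v = v_p0, the singular solution of the Bernoulli equation
     satisfied by v - v_p0, which no finite value of [C] produces. *)
Definition is_general_solution (I : R -> Prop) (f g h k A B : R -> R)
    (Phi : bool -> R -> R -> R) : Prop :=
  (forall s C x0 J y, interval J ->
     implicit_curve I g h A B Phi s C x0 J y ->
     lienard_solution I f g h k J y /\
     forall x, J x -> is_derive_on J y x (/ v_gen g h A B s C (y x))) /\
  (forall s C x0 E, interval E ->
     (forall z, E z -> v_gen_domain I B C z /\ v_gen g h A B s C z <> 0) ->
     exists J y, interval J /\ implicit_curve I g h A B Phi s C x0 J y /\
       forall z, E z -> J (x0 + Phi s C z) /\ y (x0 + Phi s C z) = z) /\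
  (forall s C x0 s' C' x0' J y, interval J ->
     implicit_curve I g h A B Phi s C x0 J y ->
     implicit_curve I g h A B Phi s' C' x0' J y ->
     s = s' /\ C = C' /\ x0 = x0') /\
  (forall J y y1, interval J ->
     lienard_solution I f g h k J y ->
     (forall x, J x -> is_derive_on J y x (y1 x) /\ y1 x <> 0) ->
     (forall x, J x -> / y1 x = v_p0 g h (y x)) \/
     exists s C x0, implicit_curve I g h A B Phi s C x0 J y).

(* Main.v *)
(* Put u = v + g/(3h) with v = 1/y'.  The coefficient v_p0 = -g/(3h) of the shift
   kills the quadratic term of the Abel equation, leaving the Bernoulli equation
   u' = (f - g^2/(3h)) u + h u^3 in y; with w = u e^(-A) it becomes
   w' = h e^(2A) w^3, so that 1/(2 w^2) + B is the constant C and v is [v_gen].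
   Along a solution y(x), w obeys a linear equation with a continuous
   coefficient, so it vanishes everywhere (v = v_p0) or nowhere, and in the
   latter case the sign of w gives the choice of +-.  Relative derivatives are
   handled through Caratheodory's criterion u(t) - u(x) = q(t) (t - x), with q
   continuous at x, which makes the chain and inverse function rules algebraic. *)

Require Import Defs.
From Stdlib Require Import Reals Lra Classical ClassicalEpsilon.
From Coquelicot Require Import Coquelicot.
Open Scope R_scope.

(** * Calculus of derivatives relative to a set, by Caratheodory's criterion *)

Lemma is_derive_on_caratheodory (D : R -> Prop) (u : R -> R) (x l : R) :
  D x ->
  is_derive_on D u x l <->
  exists q : R -> R, filterlim q (within D (locally x)) (locally l) /\
    forall t, D t -> u t - u x = q t * (t - x).
Proof.
intros Dx; split.
- intros [_ H].
  assert (Hx : is_filter_lim (within D (locally x)) x).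
  { intros P HP; unfold within; apply filter_imp with (2 := HP); auto. }
  specialize (H x Hx).
  (* The filter [within D (locally x)] does not exclude [x] itself, so the difference quotient has
     to be completed by its limit [l] there. *)
  exists (fun t => if Req_EM_T t x then l else (u t - u x) / (t - x)); split.
  + apply filterlim_locally; intros eps.
    generalize (H (pos_div_2 eps)); unfold within.
    apply filter_imp; intros t Ht Dt.
    destruct (Req_EM_T t x) as [->|Htx]; [apply ball_center|].
    specialize (Ht Dt).
    change (Rabs ((u t - u x) - ((t - x) * l)) <= eps / 2 * Rabs (t - x)) in Ht.
    change (Rabs ((u t - u x) / (t - x) - l) < eps).
    assert (Hp : 0 < Rabs (t - x)) by (apply Rabs_pos_lt; lra).
    replace ((u t - u x) / (t - x) - l)
      with (((u t - u x) - (t - x) * l) / (t - x)) by (field; lra).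
    unfold Rdiv; rewrite Rabs_mult, Rabs_inv.
    apply Rle_lt_trans with (eps / 2).
    * apply Rmult_le_reg_r with (Rabs (t - x)); [exact Hp|].
      rewrite Rmult_assoc, Rinv_l by lra; lra.
    * destruct eps; simpl; lra.
  + intros t _; destruct (Req_EM_T t x) as [->|Htx]; [ring|field; lra].
- intros (q & Hq & E); split; [exact (is_linear_scal_l (K := R_AbsRing) (V := R_NormedModule) l)|].
  (* [filterdiff] quantifies over all limits [z] of the filter; as [x] lies in [D], every ball
     around such a [z] contains [x], which leaves only [z = x]. *)
  intros z Hz; assert (z = x) as ->.
  { apply eq_close; intros eps.
    destruct (Hz _ (locally_ball z eps)) as [d Hd].
    specialize (Hd x (ball_center _ _) Dx); exact Hd. }
  intros eps.
  generalize (proj1 (filterlim_locally _ _) Hq eps); unfold within.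
  apply filter_imp; intros t Ht Dt; specialize (Ht Dt).
  change (Rabs (q t - l) < eps) in Ht.
  change (Rabs ((u t - u x) - ((t - x) * l)) <= eps * Rabs (t - x)).
  rewrite (E t Dt).
  replace (q t * (t - x) - (t - x) * l) with ((q t - l) * (t - x)) by ring.
  rewrite Rabs_mult; apply Rmult_le_compat_r; [apply Rabs_pos|lra].
Qed.

Lemma filterlim_within_comp (D E : R -> Prop) (q y : R -> R) (x l : R) :
  (forall t, D t -> E (y t)) ->
  filterlim y (within D (locally x)) (locally (y x)) ->
  filterlim q (within E (locally (y x))) (locally l) ->
  filterlim (fun t => q (y t)) (within D (locally x)) (locally l).
Proof.
intros DE Hy Hq; apply filterlim_comp with (2 := Hq).
intros P HP; generalize (Hy _ HP); unfold filtermap, within.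
apply filter_imp; auto.
Qed.

Lemma filterlim_within_mult (D : R -> Prop) (p q : R -> R) (x l m : R) :
  filterlim p (within D (locally x)) (locally l) ->
  filterlim q (within D (locally x)) (locally m) ->
  filterlim (fun t => p t * q t) (within D (locally x)) (locally (l * m)).
Proof.
intros Hp Hq; apply filterlim_comp_2 with (1 := Hp) (2 := Hq).
exact (filterlim_mult (K := R_AbsRing) l m).
Qed.

Lemma filterlim_within_plus (D : R -> Prop) (p q : R -> R) (x l m : R) :
  filterlim p (within D (locally x)) (locally l) ->
  filterlim q (within D (locally x)) (locally m) ->
  filterlim (fun t => p t + q t) (within D (locally x)) (locally (l + m)).
Proof.
intros Hp Hq; apply filterlim_comp_2 with (1 := Hp) (2 := Hq).
exact (filterlim_plus (V := R_NormedModule) l m).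
Qed.

Lemma filterlim_within_of_continuous (D : R -> Prop) (q : R -> R) (x : R) :
  continuous q x -> filterlim q (within D (locally x)) (locally (q x)).
Proof.
intros H P HP; generalize (H P HP); unfold filtermap, within.
apply filter_imp; auto.
Qed.

Lemma is_derive_on_continuous (D : R -> Prop) (u : R -> R) (x l : R) :
  D x -> is_derive_on D u x l ->
  filterlim u (within D (locally x)) (locally (u x)).
Proof.
intros Dx H; destruct (proj1 (is_derive_on_caratheodory _ _ _ _ Dx) H) as (q & Hq & E).
assert (L : filterlim (fun t => u x + q t * (t - x)) (within D (locally x))
  (locally (u x + l * (x - x)))).
{ apply filterlim_within_plus; [apply filterlim_const|].
  apply filterlim_within_mult; [exact Hq|].
  apply (filterlim_within_of_continuous D (fun t => t - x)).
  apply (continuous_minus (fun t => t) (fun _ => x) x);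
    [apply continuous_id|apply continuous_const]. }
replace (u x + l * (x - x)) with (u x) in L by ring.
apply filterlim_within_ext with (2 := L).
intros t Dt; rewrite <- (E t Dt); ring.
Qed.

Lemma is_derive_on_subset (D E : R -> Prop) (u : R -> R) (x l : R) :
  D x -> (forall t, D t -> E t) -> is_derive_on E u x l -> is_derive_on D u x l.
Proof.
intros Dx DE H.
destruct (proj1 (is_derive_on_caratheodory _ _ _ _ (DE x Dx)) H) as (q & Hq & Eq).
apply (is_derive_on_caratheodory _ _ _ _ Dx); exists q; split; [|auto].
intros P HP; generalize (Hq P HP); unfold filtermap, within.
apply filter_imp; auto.
Qed.

Lemma is_derive_on_ext (D : R -> Prop) (u v : R -> R) (x l : R) :
  D x -> (forall t, D t -> u t = v t) -> is_derive_on D u x l ->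
  is_derive_on D v x l.
Proof.
intros Dx Huv H.
destruct (proj1 (is_derive_on_caratheodory _ _ _ _ Dx) H) as (q & Hq & E).
apply (is_derive_on_caratheodory _ _ _ _ Dx); exists q; split; [exact Hq|].
intros t Dt; rewrite <- !Huv by assumption; auto.
Qed.

Lemma is_derive_on_of_is_derive (D : R -> Prop) (u : R -> R) (x l : R) :
  D x -> is_derive u x l -> is_derive_on D u x l.
Proof.
intros Dx H.
assert (PF : ProperFilter (within D (locally x))).
{ split; [|apply within_filter, locally_filter].
  intros P [d Hd]; exists x; exact (Hd x (ball_center _ _) Dx). }
apply (filterdiff_locally (F := within D (locally x)) u x); [|exact H].
intros P HP; unfold within; apply filter_imp with (2 := HP); auto.
Qed.

Lemma is_derive_on_comp (D E : R -> Prop) (F y : R -> R) (x l m : R) :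
  D x -> (forall t, D t -> E (y t)) ->
  is_derive_on E F (y x) l -> is_derive_on D y x m ->
  is_derive_on D (fun t => F (y t)) x (l * m).
Proof.
intros Dx DE HF Hy.
pose proof (is_derive_on_continuous _ _ _ _ Dx Hy) as Cy.
destruct (proj1 (is_derive_on_caratheodory _ _ _ _ (DE x Dx)) HF) as (p & Hp & Ep).
destruct (proj1 (is_derive_on_caratheodory _ _ _ _ Dx) Hy) as (q & Hq & Eq).
apply (is_derive_on_caratheodory _ _ _ _ Dx).
exists (fun t => p (y t) * q t); split.
- apply filterlim_within_mult; [|exact Hq].
  now apply filterlim_within_comp with E.
- intros t Dt; rewrite Ep, Eq by auto; ring.
Qed.

Lemma is_derive_on_comp_is_derive (D : R -> Prop) (F y : R -> R) (x l m : R) :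
  D x -> is_derive F (y x) l -> is_derive_on D y x m ->
  is_derive_on D (fun t => F (y t)) x (l * m).
Proof.
intros Dx HF Hy.
apply is_derive_on_comp with (fun _ => True); auto.
now apply is_derive_on_of_is_derive.
Qed.

Lemma is_derive_on_plus (D : R -> Prop) (u v : R -> R) (x l m : R) :
  D x -> is_derive_on D u x l -> is_derive_on D v x m ->
  is_derive_on D (fun t => u t + v t) x (l + m).
Proof.
intros Dx Hu Hv.
destruct (proj1 (is_derive_on_caratheodory _ _ _ _ Dx) Hu) as (p & Hp & Ep).
destruct (proj1 (is_derive_on_caratheodory _ _ _ _ Dx) Hv) as (q & Hq & Eq).
apply (is_derive_on_caratheodory _ _ _ _ Dx).
exists (fun t => p t + q t); split; [now apply filterlim_within_plus|].
intros t Dt; rewrite Rmult_plus_distr_r, <- Ep, <- Eq by assumption; ring.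
Qed.

Lemma is_derive_on_mult (D : R -> Prop) (u v : R -> R) (x l m : R) :
  D x -> is_derive_on D u x l -> is_derive_on D v x m ->
  is_derive_on D (fun t => u t * v t) x (l * v x + u x * m).
Proof.
intros Dx Hu Hv.
pose proof (is_derive_on_continuous _ _ _ _ Dx Hv) as Cv.
destruct (proj1 (is_derive_on_caratheodory _ _ _ _ Dx) Hu) as (p & Hp & Ep).
destruct (proj1 (is_derive_on_caratheodory _ _ _ _ Dx) Hv) as (q & Hq & Eq).
apply (is_derive_on_caratheodory _ _ _ _ Dx).
exists (fun t => p t * v t + u x * q t); split.
- apply filterlim_within_plus; apply filterlim_within_mult; trivial.
  apply filterlim_const.
- intros t Dt.
  replace ((p t * v t + u x * q t) * (t - x))
    with (p t * (t - x) * v t + u x * (q t * (t - x))) by ring.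
  rewrite <- Ep, <- Eq by assumption; ring.
Qed.

Lemma is_derive_on_scal (D : R -> Prop) (u : R -> R) (c x l : R) :
  D x -> is_derive_on D u x l -> is_derive_on D (fun t => c * u t) x (c * l).
Proof.
intros Dx Hu.
apply (is_derive_on_comp_is_derive D (fun z => c * z) u x c l Dx); [|exact Hu].
auto_derive; [trivial|ring].
Qed.

(** If [q] is the Caratheodory factor of [F] at [y x], then [t - x = q (y t) * (y t - y x)], so
    [/ q (y t)] is a factor for [y]. It converges because [y] is continuous at [x] and [l <> 0]. *)
Lemma is_derive_on_inverse (D E : R -> Prop) (F y : R -> R) (x l : R) :
  D x -> (forall t, D t -> E (y t)) ->
  filterlim y (within D (locally x)) (locally (y x)) ->
  is_derive_on E F (y x) l -> l <> 0 ->
  (forall t, D t -> F (y t) - F (y x) = t - x) ->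
  is_derive_on D y x (/ l).
Proof.
intros Dx DE Cy HF Hl HFy.
destruct (proj1 (is_derive_on_caratheodory _ _ _ _ (DE x Dx)) HF) as (q & Hq & Eq).
apply (is_derive_on_caratheodory _ _ _ _ Dx).
exists (fun t => / q (y t)); split.
- apply filterlim_comp with (locally l);
    [now apply filterlim_within_comp with E|].
  apply (filterlim_Rbar_inv l); intros [=]; auto.
- intros t Dt.
  pose proof (Eq (y t) (DE t Dt)) as H; rewrite (HFy t Dt) in H.
  (* Where the factor vanishes, [t - x = 0], and the identity at [t = x] holds whatever the value of
     [/ 0]. *)
  destruct (Req_dec (q (y t)) 0) as [H0|H0].
  + rewrite H0 in H; replace t with x by lra; ring.
  + rewrite H; field; exact H0.
Qed.

(** A nondegenerate interval has points other than [x] arbitrarily close to [x]. At such a point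
    both Caratheodory factors equal the same difference quotient, so their limits agree. *)
Lemma is_derive_on_unique (J : R -> Prop) (u : R -> R) (x l m : R) :
  interval J -> J x -> is_derive_on J u x l -> is_derive_on J u x m -> l = m.
Proof.
intros [(a & b & Ja & Jb & Hab) HJ] Jx Hl Hm.
destruct (proj1 (is_derive_on_caratheodory _ _ _ _ Jx) Hl) as (p & Hp & Ep).
destruct (proj1 (is_derive_on_caratheodory _ _ _ _ Jx) Hm) as (q & Hq & Eq).
assert (Hc : exists c, J c /\ c <> x).
{ destruct (Req_dec a x); [exists b|exists a]; split; trivial; lra. }
destruct Hc as (c & Jc & Hcx).
apply eq_close; intros eps.
pose proof (proj1 (filterlim_locally _ _) Hp (pos_div_2 eps)) as Hp'.
pose proof (proj1 (filterlim_locally _ _) Hq (pos_div_2 eps)) as Hq'.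
destruct (filter_and _ _ Hp' Hq') as [d Hd].
assert (Hcx' : 0 < Rabs (c - x)) by (apply Rabs_pos_lt; lra).
(* The point [x + th * (c - x)] stays on the segment from [x] to [c], hence in [J], because
   [th <= 1]; the other bound puts it within [d / 2] of [x]. *)
set (th := Rmin 1 (d / (2 * Rabs (c - x)))).
assert (H0 : 0 < d / (2 * Rabs (c - x))).
{ apply Rdiv_lt_0_compat; [apply cond_pos|lra]. }
assert (Hth : 0 < th <= 1 /\ th <= d / (2 * Rabs (c - x))).
{ unfold th; split; [split|]; [apply Rmin_glb_lt; lra|apply Rmin_l|apply Rmin_r]. }
assert (Jt : J (x + th * (c - x))).
{ destruct (Rlt_dec x c).
  - apply HJ with x c; trivial; nra.
  - apply HJ with c x; trivial; nra. }
assert (Bt : ball x d (x + th * (c - x))).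
{ change (Rabs (x + th * (c - x) - x) < d).
  replace (x + th * (c - x) - x) with (th * (c - x)) by ring.
  rewrite Rabs_mult, (Rabs_pos_eq th) by lra.
  apply Rle_lt_trans with (d / (2 * Rabs (c - x)) * Rabs (c - x)).
  - apply Rmult_le_compat_r; lra.
  - replace (d / (2 * Rabs (c - x)) * Rabs (c - x)) with (d / 2) by (field; lra).
    generalize (cond_pos d); lra. }
destruct (Hd _ Bt Jt) as [B1 B2].
set (t := x + th * (c - x)) in *.
assert (Htx : t - x <> 0).
{ unfold t; replace (x + th * (c - x) - x) with (th * (c - x)) by ring.
  apply Rmult_integral_contrapositive; split; lra. }
assert (p t = q t) as E.
{ apply Rmult_eq_reg_r with (t - x); [|exact Htx].
  now rewrite <- Ep, <- Eq. }
rewrite E in B1.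
replace (pos eps) with (pos_div_2 eps + pos_div_2 eps) by (simpl; lra).
apply ball_triangle with (q t); [exact B1|exact (ball_sym _ _ _ B2)].
Qed.

(** * Mean value, intermediate value and uniqueness theorems on arbitrary intervals *)

(** Composing with this retraction onto [[a, b]] turns a function continuous relative to an interval
    into one continuous on all of R, to which the two-sided theorems apply. *)
Definition clamp (a b x : R) : R := Rmax a (Rmin b x).

Lemma clamp_id (a b x : R) : a <= x <= b -> clamp a b x = x.
Proof. intros H; unfold clamp; rewrite Rmin_right, Rmax_right; lra. Qed.

Lemma clamp_bounds (a b x : R) : a <= b -> a <= clamp a b x <= b.
Proof.
intros H; unfold clamp; split; [apply Rmax_l|].
apply Rmax_lub; [exact H|apply Rmin_l].
Qed.

Lemma clamp_continuous (a b x : R) : continuous (clamp a b) x.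
Proof.
apply filterlim_locally; intros eps; exists eps; intros t Ht.
change (Rabs (t - x) < eps) in Ht.
change (Rabs (clamp a b t - clamp a b x) < eps).
revert Ht; unfold clamp, Rmax, Rmin.
repeat destruct (Rle_dec _ _); unfold Rabs; repeat destruct (Rcase_abs _); lra.
Qed.

Lemma continuous_clamp (J : R -> Prop) (u : R -> R) (a b x : R) :
  interval J -> J a -> J b -> a <= b -> continuous_on J u ->
  continuous (fun t => u (clamp a b t)) x.
Proof.
intros [_ HJ] Ja Jb Hab Cu.
assert (Jc : forall t, J (clamp a b t)).
{ intros t; apply HJ with a b; trivial; now apply clamp_bounds. }
intros P HP; generalize (clamp_continuous a b x _ (Cu _ (Jc x) P HP)).
unfold filtermap; apply filter_imp; auto.
Qed.

Lemma is_derive_of_interior (J : R -> Prop) (u v : R -> R) (x l : R) :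
  J x -> locally x J -> locally x (fun t => v t = u t) ->
  is_derive_on J u x l -> is_derive v x l.
Proof.
intros Jx LJ Euv [Hlin H]; apply is_derive_ext_loc with u.
{ revert Euv; apply filter_imp; auto. }
split; [exact (is_linear_scal_l (K := R_AbsRing) (V := R_NormedModule) l)|].
intros z Hz eps.
assert (Hz' : is_filter_lim (within J (locally x)) z).
{ intros P HP; unfold within; generalize (Hz P HP); apply filter_imp; auto. }
generalize (filter_and _ _ LJ (H z Hz' eps)); apply filter_imp.
intros t [Jt Ht]; exact (Ht Jt).
Qed.

(** The clamped function is continuous everywhere and coincides with [u] on the open interval from
    [a] to [b], where the relative derivative is the usual one; the classical mean value theorem
    applies to it. *)
Lemma MVT_on (J : R -> Prop) (u l : R -> R) (a b : R) :
  interval J -> antiderivative_on J l u -> J a -> J b -> a < b ->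
  exists c, J c /\ u b - u a = l c * (b - a).
Proof.
intros IJ Hu Ja Jb Hab.
assert (JJ : forall c, a <= c <= b -> J c).
{ intros c; now apply (proj2 IJ). }
destruct (MVT_gen (fun t => u (clamp a b t)) a b l) as (c & Hc & E).
- intros x; rewrite Rmin_left, Rmax_right by lra; intros Hx.
  assert (L : locally x (fun t => a < t < b)).
  { apply filter_and; [apply (open_gt a)|apply (open_lt b)]; lra. }
  apply is_derive_of_interior with J u.
  + apply JJ; lra.
  + revert L; apply filter_imp; intros t Ht; apply JJ; lra.
  + revert L; apply filter_imp; intros t Ht; rewrite clamp_id; lra.
  + apply Hu, JJ; lra.
- intros x _; apply continuity_pt_filterlim.
  apply (continuous_clamp J); trivial; [lra|].
  intros t Jt; apply is_derive_on_continuous with (l t); auto.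
- rewrite Rmin_left, Rmax_right in Hc by lra.
  rewrite !clamp_id in E by lra; exists c; auto.
Qed.

Lemma antiderivative_on_zero_const (J : R -> Prop) (u : R -> R) (a b : R) :
  interval J -> antiderivative_on J (fun _ => 0) u -> J a -> J b -> u a = u b.
Proof.
intros IJ Hu Ja Jb.
destruct (Rtotal_order a b) as [H|[->|H]]; trivial.
- destruct (MVT_on J u _ a b IJ Hu Ja Jb H) as (c & _ & E); lra.
- destruct (MVT_on J u _ b a IJ Hu Jb Ja H) as (c & _ & E); lra.
Qed.

(** The values at [a] and [b] are ordered but the points need not be, hence the clamping between
    their minimum and maximum. *)
Lemma IVT_on (J : R -> Prop) (u : R -> R) (a b t : R) :
  interval J -> continuous_on J u -> J a -> J b -> u a <= t <= u b ->
  exists c, J c /\ u c = t.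
Proof.
intros IJ Cu Ja Jb Ht.
assert (Ha : J (Rmin a b)) by (unfold Rmin; destruct (Rle_dec a b); trivial).
assert (Hb : J (Rmax a b)) by (unfold Rmax; destruct (Rle_dec a b); trivial).
pose proof (Rmin_l a b); pose proof (Rmin_r a b).
pose proof (Rmax_l a b); pose proof (Rmax_r a b).
destruct (IVT_gen (fun x => u (clamp (Rmin a b) (Rmax a b) x)) a b t)
  as (c & Hc & E).
- intros x; apply continuity_pt_filterlim.
  apply (continuous_clamp J); trivial; lra.
- rewrite !clamp_id by lra.
  rewrite Rmin_left, Rmax_right by lra; exact Ht.
- exists (clamp (Rmin a b) (Rmax a b) c); split; [|exact E].
  apply (proj2 IJ) with (Rmin a b) (Rmax a b); trivial.
  apply clamp_bounds; lra.
Qed.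

Lemma continuous_on_constant_sign (J : R -> Prop) (u : R -> R) :
  interval J -> continuous_on J u -> (forall x, J x -> u x <> 0) ->
  (forall x, J x -> 0 < u x) \/ (forall x, J x -> u x < 0).
Proof.
intros IJ Cu Hu.
destruct (classic (exists a, J a /\ u a < 0)) as [(a & Ja & Ha)|N].
- right; intros x Jx; destruct (Rlt_le_dec (u x) 0) as [|H]; trivial.
  destruct (IVT_on J u a x 0 IJ Cu Ja Jx) as (c & Jc & E); [lra|].
  destruct (Hu c Jc E).
- left; intros x Jx; destruct (Rtotal_order (u x) 0) as [H|[H|H]]; trivial.
  + destruct N; eauto.
  + destruct (Hu x Jx H).
Qed.

(* Integrating factor: [u] times the exponential of minus a primitive of [c] is
   constant. *)
Lemma linear_ode_zero (J : R -> Prop) (u c : R -> R) (a b : R) :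
  interval J -> continuous_on J c ->
  antiderivative_on J (fun x => c x * u x) u ->
  J a -> J b -> u a = 0 -> u b = 0.
Proof.
intros IJ Cc Hu Ja Jb Ha.
(* Stated as an equivalence for [a < b], so that zeros propagate in both directions. *)
assert (M : forall a b, J a -> J b -> a < b -> (u a = 0 <-> u b = 0)).
{ clear a b Ja Jb Ha; intros a b Ja Jb Hab.
  (* The clamped coefficient is continuous on R and equals [c] on [[a, b]], so its integral [K] is a
     two-sided primitive there. *)
  set (c' := fun t => c (clamp a b t)).
  assert (Cc' : forall x, continuous c' x).
  { intros x; apply (continuous_clamp J); trivial; lra. }
  set (K := RInt c' a).
  assert (HK : forall x, is_derive K x (c' x)).
  { intros x; apply is_derive_RInt with a; [|apply Cc'].
    exists (mkposreal 1 Rlt_0_1); intros t _.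
    apply (RInt_correct c'), ex_RInt_continuous; auto. }
  assert (IS : interval (fun x => a <= x <= b)).
  { split; [exists a, b; lra|intros; lra]. }
  assert (E : u a * exp (- K a) = u b * exp (- K b)).
  { apply (antiderivative_on_zero_const (fun x => a <= x <= b)
      (fun x => u x * exp (- K x))); trivial; try lra.
    intros x Hx.
    assert (Jx : J x) by (apply (proj2 IJ) with a b; trivial).
    replace 0 with (c x * u x * exp (- K x) + u x * (- exp (- K x) * c' x)).
    - apply (is_derive_on_mult _ u (fun x => exp (- K x))); trivial.
      + apply is_derive_on_subset with J; trivial.
        * intros t; now apply (proj2 IJ).
        * now apply Hu.
      + apply (is_derive_on_comp_is_derive _ (fun z => exp (- z)) K); trivial.
        * auto_derive; [trivial|ring].
        * apply is_derive_on_of_is_derive; [exact Hx|apply HK].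
    - unfold c'; rewrite clamp_id by trivial; ring. }
  pose proof (exp_pos (- K a)); pose proof (exp_pos (- K b)).
  split; intros H1; rewrite H1 in E; nra. }
destruct (Rtotal_order a b) as [H|[<-|H]]; trivial.
- now apply (M a b).
- now apply (M b a).
Qed.

(** If [z + eps] belongs to [E], then [F w < F (z + eps)] forces [w < z + eps]; if not, no point of
    [E] reaches that far and the bound is automatic. The lower side is symmetric. *)
Lemma strictly_increasing_inverse_continuous (E : R -> Prop) (F : R -> R) (z : R)
    (eps : posreal) :
  interval E -> (forall a b, E a -> E b -> a < b -> F a < F b) -> E z ->
  exists d : posreal, forall w, E w -> Rabs (F w - F z) < d -> Rabs (w - z) < eps.
Proof.
intros [_ HE] HF Ez; pose proof (cond_pos eps) as He.
assert (HF' : forall a b, E a -> E b -> F a < F b -> a < b).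
{ intros a b Ea Eb H; destruct (Rtotal_order a b) as [|[->|H']]; trivial; [lra|].
  generalize (HF b a Eb Ea H'); lra. }
assert (U : exists d : posreal, forall w, E w -> F w - F z < d -> w < z + eps).
{ destruct (classic (exists c, E c /\ z + eps <= c)) as [(c & Ec & Hc)|N].
  - assert (Ez' : E (z + eps)) by (apply HE with z c; trivial; lra).
    assert (Hd : 0 < F (z + eps) - F z).
    { generalize (HF z (z + eps) Ez Ez'); lra. }
    exists (mkposreal _ Hd); simpl; intros w Ew Hw; apply HF'; trivial; lra.
  - exists (mkposreal 1 Rlt_0_1); intros w Ew _.
    destruct (Rlt_le_dec w (z + eps)) as [|H]; trivial; destruct N; eauto. }
assert (L : exists d : posreal, forall w, E w -> F z - F w < d -> z - eps < w).
{ destruct (classic (exists c, E c /\ c <= z - eps)) as [(c & Ec & Hc)|N].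
  - assert (Ez' : E (z - eps)) by (apply HE with c z; trivial; lra).
    assert (Hd : 0 < F z - F (z - eps)).
    { generalize (HF (z - eps) z Ez' Ez); lra. }
    exists (mkposreal _ Hd); simpl; intros w Ew Hw; apply HF'; trivial; lra.
  - exists (mkposreal 1 Rlt_0_1); intros w Ew _.
    destruct (Rlt_le_dec (z - eps) w) as [|H]; trivial; destruct N; eauto. }
destruct U as [d1 U], L as [d2 L].
assert (Hd : 0 < Rmin d1 d2) by (apply Rmin_glb_lt; apply cond_pos).
exists (mkposreal _ Hd); simpl; intros w Ew Hw.
apply Rabs_def2 in Hw.
pose proof (Rmin_l d1 d2); pose proof (Rmin_r d1 d2).
specialize (U w Ew); specialize (L w Ew).
apply Rabs_def1; lra.
Qed.

(** * The explicit family solves the Abel equation, and its curves solve the Liénard equation *)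

Lemma is_derive_inv_sqrt (C z : R) :
  0 < C - z ->
  is_derive (fun z => / (sqrt 2 * sqrt (C - z))) z
    (/ (2 * sqrt 2 * sqrt (C - z) ^ 3)).
Proof.
intros H.
assert (H2 : 0 < sqrt 2) by (apply sqrt_lt_R0; lra).
assert (HS : 0 < sqrt (C - z)) by (apply sqrt_lt_R0; lra).
auto_derive.
- repeat split; trivial; unfold Rminus in *; trivial.
  apply Rgt_not_eq, Rmult_lt_0_compat; trivial.
- change (C + - z) with (C - z); field; split; lra.
Qed.

(* Shifting by a particular solution turns the Abel equation into the Bernoulli
   equation u' = (f - g^2/(3h)) u + h u^3: the choice -g/(3h) kills the
   quadratic term. *)
Lemma abel_shift (f g h k u : R) :
  h <> 0 ->
  let p := - (g / (3 * h)) in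
  k + f * (u + p) + g * (u + p) ^ 2 + h * (u + p) ^ 3 =
  (f - g ^ 2 / (3 * h)) * u + h * u ^ 3 + (k + f * p + g * p ^ 2 + h * p ^ 3).
Proof. intros Hh p; unfold p; field; exact Hh. Qed.

(** The part added to [v_p0] solves the Bernoulli equation: differentiating [exp A] gives the linear
    term, and differentiating [/ (sqrt 2 * sqrt (C - B))] with [B' = h * exp (2 * A)] gives [h]
    times its cube. *)
Lemma v_gen_abel (I : R -> Prop) (f g h k A B : R -> R) (s : bool) (C : R) :
  (forall y, I y -> h y <> 0) ->
  abel_solution I f g h k (v_p0 g h) ->
  antiderivative_on I (fun y => f y - g y ^ 2 / (3 * h y)) A ->
  antiderivative_on I (fun y => h y * exp (2 * A y)) B ->
  abel_solution (v_gen_domain I B C) f g h k (v_gen g h A B s C).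
Proof.
intros Hh Hp HA HB y Dy; pose proof Dy as [Iy Cy].
assert (DI : forall t, v_gen_domain I B C t -> I t) by (intros t []; trivial).
set (a := f y - g y ^ 2 / (3 * h y)).
set (D := v_gen_domain I B C) in *.
assert (dA : is_derive_on D A y a) by (apply is_derive_on_subset with I; auto).
assert (dB : is_derive_on D B y (h y * exp (2 * A y))).
{ apply is_derive_on_subset with I; auto. }
assert (dp := is_derive_on_subset D I _ y _ Dy DI (Hp y Iy)).
assert (dE := is_derive_on_comp_is_derive D exp A y _ _ Dy (is_derive_exp _) dA).
assert (dS := is_derive_on_comp_is_derive D _ B y _ _ Dy
  (is_derive_inv_sqrt C (B y) Cy) dB).
assert (dv := is_derive_on_plus _ _ _ _ _ _ Dy (is_derive_on_scal D _ (pm s) y _ Dy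
  (is_derive_on_mult D _ _ y _ _ Dy dE dS)) dp).
change (is_derive_on D (v_gen g h A B s C) y
  (k y + f y * v_gen g h A B s C y + g y * v_gen g h A B s C y ^ 2
    + h y * v_gen g h A B s C y ^ 3)).
assert (V : v_gen g h A B s C y
  = pm s * (exp (A y) / (sqrt 2 * sqrt (C - B y))) + - (g y / (3 * h y))).
{ reflexivity. }
rewrite V, abel_shift by auto.
fold a; change (- (g y / (3 * h y))) with (v_p0 g h y).
eapply eq_rect; [exact dv|].
f_equal.
assert (H2 : 0 < sqrt 2) by (apply sqrt_lt_R0; lra).
assert (HS : 0 < sqrt (C - B y)) by (apply sqrt_lt_R0; lra).
assert (Q2 : sqrt 2 ^ 2 = 2) by (apply pow2_sqrt; lra).
replace (exp (2 * A y)) with (exp (A y) ^ 2)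
  by (replace (2 * A y) with (A y + A y) by ring; rewrite exp_plus; ring).
(* A sign equals its own cube, so both choices satisfy the same cubic equation. *)
assert (Ps : pm s ^ 3 = pm s) by (destruct s; simpl; ring).
rewrite Rpow_mult_distr, Ps.
replace ((exp (A y) / (sqrt 2 * sqrt (C - B y))) ^ 3)
  with (exp (A y) ^ 3 / (sqrt 2 ^ 2 * sqrt 2 * sqrt (C - B y) ^ 3))
  by (field; split; lra).
rewrite Q2; field; split; lra.
Qed.

(* In x, with v = 1/y', the equation reads y'' = - v_y / v^3. *)
Lemma abel_solution_lienard (I D : R -> Prop) (f g h k v : R -> R)
    (J : R -> Prop) (y : R -> R) :
  (forall z, D z -> I z) -> abel_solution D f g h k v ->
  (forall x, J x -> D (y x) /\ v (y x) <> 0) ->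
  (forall x, J x -> is_derive_on J y x (/ v (y x))) ->
  lienard_solution I f g h k J y.
Proof.
intros DI Hv HD Hy.
set (r := fun z => k z + f z * v z + g z * v z ^ 2 + h z * v z ^ 3).
exists (fun x => / v (y x)), (fun x => - / v (y x) ^ 2 * (r (y x) * / v (y x))).
intros x Jx; destruct (HD x Jx) as [Dy Nv].
split; [auto|split; [auto|split]].
- apply (is_derive_on_comp_is_derive J Rinv (fun t => v (y t))); trivial.
  + auto_derive; [exact Nv|field; exact Nv].
  + apply is_derive_on_comp with D; auto.
    intros t Jt; apply (HD t Jt).
- unfold r; field; exact Nv.
Qed.

(** Subtracting the relation [x - x0 = Phi s C (y x)] at two points gives exactly the hypothesis of
    the inverse function rule. *)
Lemma implicit_curve_derive (I : R -> Prop) (g h A B : R -> R)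
    (Phi : bool -> R -> R -> R) (s : bool) (C x0 : R) (J : R -> Prop)
    (y : R -> R) :
  antiderivative_on (v_gen_domain I B C) (v_gen g h A B s C) (Phi s C) ->
  implicit_curve I g h A B Phi s C x0 J y ->
  forall x, J x -> is_derive_on J y x (/ v_gen g h A B s C (y x)).
Proof.
intros HPhi [Cy H] x Jx.
apply is_derive_on_inverse with (v_gen_domain I B C) (Phi s C); trivial.
- intros t Jt; apply (H t Jt).
- now apply Cy.
- apply HPhi, (H x Jx).
- apply (H x Jx).
- intros t Jt; destruct (H t Jt) as (_ & _ & <-), (H x Jx) as (_ & _ & <-); ring.
Qed.

(** * Inverting the implicit relation to obtain a branch *)

Lemma antiderivative_on_sub (D E : R -> Prop) (u U : R -> R) :
  (forall z, E z -> D z) -> antiderivative_on D u U -> antiderivative_on E u U.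
Proof. intros ED H z Ez; apply is_derive_on_subset with D; auto. Qed.

(** This supplies a member of the family through a given interval [E], with [U] as [Phi s C] and [c]
    as [x0]. A continuous nowhere zero [u] keeps one sign, so [U] is strictly monotone; its inverse
    is continuous on the image [J], an interval by the intermediate value theorem. *)
Lemma nonzero_derivative_inverse (E : R -> Prop) (u U : R -> R) (c : R) :
  interval E -> continuous_on E u -> antiderivative_on E u U ->
  (forall z, E z -> u z <> 0) ->
  let J := fun x => exists z, E z /\ x = c + U z in
  exists y, interval J /\ continuous_on J y /\
    (forall x, J x -> E (y x) /\ x - c = U (y x)) /\
    (forall z, E z -> J (c + U z) /\ y (c + U z) = z).
Proof.
intros IE Cu HU Nu J.
(* The factor [r] is the sign of [u]; it reduces the decreasing case to the increasing one. *)
assert (HM : exists r, (r = 1 \/ r = -1) /\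
  forall a b, E a -> E b -> a < b -> r * U a < r * U b).
{ destruct (continuous_on_constant_sign E u IE Cu Nu) as [P|P];
    [exists 1|exists (-1)]; (split; [auto|]); intros a b Ea Eb Hab;
    destruct (MVT_on E U u a b IE HU Ea Eb Hab) as (m & Em & Hm);
    specialize (P m Em); nra. }
destruct HM as (r & Hr & HM).
assert (HI : forall a b, E a -> E b -> U a = U b -> a = b).
{ intros a b Ea Eb Hab; destruct (Rtotal_order a b) as [H|[H|H]]; trivial.
  - generalize (HM a b Ea Eb H); rewrite Hab; lra.
  - generalize (HM b a Eb Ea H); rewrite Hab; lra. }
(* The preimage under [c + U] is selected by choice; outside [J] the value is arbitrary. *)
set (y := fun x => epsilon (inhabits 0) (fun z => E z /\ x = c + U z)).
assert (Hy : forall x, J x -> E (y x) /\ x = c + U (y x)).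
{ intros x Jx; exact (epsilon_spec (inhabits 0) _ Jx). }
assert (Hyz : forall z, E z -> J (c + U z) /\ y (c + U z) = z).
{ intros z Ez.
  assert (Jz : J (c + U z)) by (exists z; auto).
  split; [exact Jz|]; destruct (Hy _ Jz) as [Ey H].
  apply HI; trivial; lra. }
exists y; split; [split|split; [|split; [|exact Hyz]]].
- destruct IE as [(a & b & Ea & Eb & Hab) _].
  pose proof (HM a b Ea Eb Hab).
  destruct (Rlt_le_dec (U a) (U b)) as [H1|H1].
  + exists (c + U a), (c + U b); repeat split; try (now apply Hyz); lra.
  + exists (c + U b), (c + U a); repeat split; try (now apply Hyz).
    destruct Hr as [-> | ->]; lra.
- intros x1 x2 x (a & Ea & ->) (b & Eb & ->) Hx.
  destruct (IVT_on E U a b (x - c) IE) as (z & Ez & Hz); trivial; [|lra|].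
  + intros z Ez; apply is_derive_on_continuous with (u z); auto.
  + exists z; split; [exact Ez|lra].
- intros x Jx; apply filterlim_locally; intros eps.
  destruct (Hy x Jx) as [Ey Ex].
  destruct (strictly_increasing_inverse_continuous E (fun z => r * U z) (y x) eps
    IE HM Ey) as [d Hd].
  exists d; intros t Ht Jt; destruct (Hy t Jt) as [Eyt Et].
  change (Rabs (t - x) < d) in Ht; change (Rabs (y t - y x) < eps).
  apply Hd; trivial.
  replace (r * U (y t) - r * U (y x)) with (r * (t - x)) by (rewrite Et, Ex at 1; ring).
  rewrite Rabs_mult; destruct Hr as [-> | ->];
    [rewrite Rabs_R1|rewrite Rabs_m1]; lra.
- intros x Jx; destruct (Hy x Jx) as [Ey Ex]; split; [exact Ey|lra].
Qed.

(** * Independence of the constants and completeness of the family *)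

(** One point [y] is enough: the fraction with the exponential is positive, so the sign of
    [v_gen - v_p0] determines [s], and its absolute value then determines [C]. *)
Lemma v_gen_injective (g h A B : R -> R) (s s' : bool) (C C' y : R) :
  0 < C - B y -> 0 < C' - B y ->
  v_gen g h A B s C y = v_gen g h A B s' C' y -> s = s' /\ C = C'.
Proof.
intros HC HC' E.
assert (H2 : 0 < sqrt 2) by (apply sqrt_lt_R0; lra).
assert (P : forall c, 0 < c -> 0 < exp (A y) / (sqrt 2 * sqrt c)).
{ intros c Hc; apply Rdiv_lt_0_compat; [apply exp_pos|].
  apply Rmult_lt_0_compat, sqrt_lt_R0; trivial. }
pose proof (P _ HC) as P1; pose proof (P _ HC') as P2.
unfold v_gen in E.
assert (s = s') as <-.
{ destruct s, s'; trivial; unfold pm in E; lra. }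
split; [reflexivity|].
assert (F : exp (A y) / (sqrt 2 * sqrt (C - B y))
  = exp (A y) / (sqrt 2 * sqrt (C' - B y))).
{ destruct s; unfold pm in E; lra. }
assert (S1 : 0 < sqrt (C - B y)) by now apply sqrt_lt_R0.
assert (S2 : 0 < sqrt (C' - B y)) by now apply sqrt_lt_R0.
pose proof (exp_pos (A y)).
assert (sqrt (C - B y) = sqrt (C' - B y)) as G.
{ apply Rinv_eq_reg, Rmult_eq_reg_l with (exp (A y) / sqrt 2).
  - replace (exp (A y) / sqrt 2 * / sqrt (C - B y))
      with (exp (A y) / (sqrt 2 * sqrt (C - B y))) by (field; split; lra).
    rewrite F; field; split; lra.
  - apply Rgt_not_eq, Rdiv_lt_0_compat; trivial. }
apply sqrt_inj in G; lra.
Qed.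

(** Solving [C = B + 1/(2 w^2)] gives [sqrt 2 * sqrt (C - B) = 1 / |w|]; the choice of sign by
    [Rlt_dec] turns [|w|] back into [w]. *)
Lemma v_gen_of_bernoulli (g h A B : R -> R) (C y w : R) :
  w <> 0 -> C = B y + / (2 * w ^ 2) ->
  0 < C - B y /\
  v_gen g h A B (if Rlt_dec 0 w then true else false) C y
    = w * exp (A y) + v_p0 g h y.
Proof.
intros Hw ->.
assert (W : 0 < w ^ 2) by (apply pow2_gt_0; exact Hw).
replace (B y + / (2 * w ^ 2) - B y) with (/ (2 * w ^ 2)) by ring.
assert (P : 0 < / (2 * w ^ 2)) by (apply Rinv_0_lt_compat; lra).
split; [exact P|].
assert (H2 : 0 < sqrt 2) by (apply sqrt_lt_R0; lra).
assert (HS : sqrt 2 * sqrt (B y + / (2 * w ^ 2) - B y) = / Rabs w).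
{ replace (B y + / (2 * w ^ 2) - B y) with (/ (2 * w ^ 2)) by ring.
  rewrite sqrt_inv, sqrt_mult, <- (pow2_abs w), sqrt_pow2; try lra.
  - field; split; [now apply Rabs_no_R0|lra].
  - apply Rabs_pos. }
unfold v_gen, v_p0; rewrite HS; unfold pm.
destruct (Rlt_dec 0 w) as [Hp|Hp].
- rewrite Rabs_pos_eq by lra; unfold Rdiv; rewrite Rinv_inv; ring.
- rewrite Rabs_left by lra; unfold Rdiv; rewrite Rinv_inv; ring.
Qed.

(** The equation [w' = h e^(2A) w^3] in the variable [y], transported to [x] along the solution: the
    chain rule contributes the factor [y1 x]. *)
Lemma lienard_bernoulli (I : R -> Prop) (f g h k A : R -> R) (J : R -> Prop)
    (y y1 : R -> R) :
  (forall z, I z -> h z <> 0) ->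
  abel_solution I f g h k (v_p0 g h) ->
  antiderivative_on I (fun z => f z - g z ^ 2 / (3 * h z)) A ->
  interval J -> lienard_solution I f g h k J y ->
  (forall x, J x -> is_derive_on J y x (y1 x) /\ y1 x <> 0) ->
  let w := fun x => (/ y1 x - v_p0 g h (y x)) * exp (- A (y x)) in
  continuous_on J y1 /\
  antiderivative_on J (fun x => y1 x * (h (y x) * exp (2 * A (y x))) * w x ^ 3) w.
Proof.
intros Hh Hp HA IJ (z1 & y2 & HL) Hy w.
(* The first derivative hidden in [lienard_solution] is identified with the given [y1], which
   thereby becomes differentiable. *)
assert (Hz : forall x, J x -> z1 x = y1 x).
{ intros x Jx; apply (is_derive_on_unique J y x); trivial; [apply (HL x Jx)|].
  apply (Hy x Jx). }
assert (dy1 : forall x, J x -> is_derive_on J y1 x (y2 x)).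
{ intros x Jx; apply is_derive_on_ext with z1; trivial; apply (HL x Jx). }
assert (JI : forall t, J t -> I (y t)) by (intros t Jt; apply (HL t Jt)).
split.
{ intros x Jx; apply is_derive_on_continuous with (y2 x); auto. }
intros x Jx; destruct (HL x Jx) as (Iy & _ & _ & E), (Hy x Jx) as [dy N1].
rewrite (Hz x Jx) in E.
assert (dv := is_derive_on_comp_is_derive J Rinv y1 x (- / y1 x ^ 2) _ Jx
  ltac:(auto_derive; [exact N1|field; exact N1]) (dy1 x Jx)).
assert (dp := is_derive_on_comp J I (v_p0 g h) y x _ _ Jx JI (Hp _ Iy) dy).
assert (dA := is_derive_on_comp J I A y x _ _ Jx JI (HA _ Iy) dy).
assert (de := is_derive_on_comp_is_derive J (fun z => exp (- z)) (fun t => A (y t))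
  x (- exp (- A (y x))) _ Jx ltac:(auto_derive; [trivial|ring]) dA).
assert (dw := is_derive_on_mult J _ _ x _ _ Jx (is_derive_on_plus J _ _ x _ _ Jx dv
  (is_derive_on_scal J _ (-1) x _ Jx dp)) de).
apply is_derive_on_ext with (fun t => (/ y1 t + -1 * v_p0 g h (y t)) * exp (- A (y t)));
  trivial; [intros t _; unfold w; ring|].
eapply eq_rect; [exact dw|]; cbv beta.
pose proof (abel_shift (f (y x)) (g (y x)) (h (y x)) (k (y x))
  (/ y1 x - v_p0 g h (y x)) (Hh _ Iy)) as S; cbv zeta in S.
change (- (g (y x) / (3 * h (y x)))) with (v_p0 g h (y x)) in S.
set (p := v_p0 g h (y x)) in *.
replace (/ y1 x - p + p) with (/ y1 x) in S by ring.
(* With [y''] taken from the equation, [(1/y')'] is [y'] times the Abel right-hand side at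
   [v = 1/y']. *)
assert (V : - / y1 x ^ 2 * y2 x = y1 x * (k (y x) + f (y x) * / y1 x
  + g (y x) * (/ y1 x) ^ 2 + h (y x) * (/ y1 x) ^ 3)).
{ replace (y2 x) with (- (f (y x) * y1 x ^ 2 + k (y x) * y1 x ^ 3
    + g (y x) * y1 x + h (y x))) by lra.
  field; exact N1. }
rewrite V, S; unfold w; fold p.
(* Two of the three exponentials in [w ^ 3] cancel against [exp (2 * A)], leaving the single
   [exp (- A)] present on the other side. *)
assert (X : exp (2 * A (y x)) * exp (- A (y x)) ^ 2 = 1).
{ replace (exp (- A (y x)) ^ 2) with (exp (- A (y x) + - A (y x)))
    by (rewrite exp_plus; ring).
  rewrite <- exp_plus, <- exp_0; f_equal; ring. }
set (u := / y1 x - p) in *.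
replace (y1 x * (h (y x) * exp (2 * A (y x))) * (u * exp (- A (y x))) ^ 3)
  with (y1 x * h (y x) * u ^ 3 * exp (- A (y x))
    * (exp (2 * A (y x)) * exp (- A (y x)) ^ 2)) by ring.
rewrite X; replace (/ y1 x + -1 * p) with u by (unfold u; ring); ring.
Qed.

Lemma lienard_solution_implicit (I : R -> Prop) (f g h k A B : R -> R)
    (Phi : bool -> R -> R -> R) (J : R -> Prop) (y y1 : R -> R) :
  continuous_on I h ->
  (forall z, I z -> h z <> 0) ->
  abel_solution I f g h k (v_p0 g h) ->
  antiderivative_on I (fun z => f z - g z ^ 2 / (3 * h z)) A ->
  antiderivative_on I (fun z => h z * exp (2 * A z)) B ->
  (forall s C,
     antiderivative_on (v_gen_domain I B C) (v_gen g h A B s C) (Phi s C)) ->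
  interval J -> lienard_solution I f g h k J y ->
  (forall x, J x -> is_derive_on J y x (y1 x) /\ y1 x <> 0) ->
  (forall x, J x -> / y1 x = v_p0 g h (y x)) \/
  exists s C x0, implicit_curve I g h A B Phi s C x0 J y.
Proof.
intros Ch Hh Hp HA HB HPhi IJ HL Hy.
destruct (lienard_bernoulli I f g h k A J y y1 Hh Hp HA IJ HL Hy) as [Cy1 Hw].
set (w := fun x => (/ y1 x - v_p0 g h (y x)) * exp (- A (y x))) in *.
change (antiderivative_on J
  (fun x => y1 x * (h (y x) * exp (2 * A (y x))) * w x ^ 3) w) in Hw.
assert (JI : forall t, J t -> I (y t)).
{ destruct HL as (z1 & z2 & HL); intros t Jt; apply (HL t Jt). }
assert (Cy : continuous_on J y).
{ intros x Jx; apply is_derive_on_continuous with (y1 x); trivial; now apply Hy. }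
assert (Cw : continuous_on J w).
{ intros x Jx; eapply is_derive_on_continuous; [exact Jx|exact (Hw x Jx)]. }
(* The cubic equation is read as [w' = c w] with [w ^ 2] absorbed in the coefficient; for a given
   solution [c] is just a continuous function of [x]. *)
set (c := fun x => y1 x * (h (y x) * exp (2 * A (y x))) * (w x * w x)).
assert (Cc : continuous_on J c).
{ intros x Jx; unfold c.
  apply filterlim_within_mult; [|apply filterlim_within_mult; auto].
  apply filterlim_within_mult; [auto|apply filterlim_within_mult].
  - apply filterlim_within_comp with I; auto.
  - assert (CA : filterlim A (within I (locally (y x))) (locally (A (y x)))).
    { eapply is_derive_on_continuous; [auto|exact (HA _ (JI x Jx))]. }
    apply (filterlim_within_comp J (fun _ => True) (fun z => exp (2 * z))
      (fun t => A (y t))); trivial.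
    + apply filterlim_within_comp with I; auto.
    + apply (filterlim_within_of_continuous _ (fun z => exp (2 * z))).
      apply (ex_derive_continuous (fun z => exp (2 * z))); auto_derive; trivial. }
assert (Hwc : antiderivative_on J (fun x => c x * w x) w).
{ intros x Jx; replace (c x * w x)
    with (y1 x * (h (y x) * exp (2 * A (y x))) * w x ^ 3) by (unfold c; ring).
  now apply Hw. }
assert (Ew : forall x, / y1 x = w x * exp (A (y x)) + v_p0 g h (y x)).
{ intros x; unfold w; rewrite Rmult_assoc, <- exp_plus, Rplus_opp_l, exp_0; ring. }
destruct (classic (exists a, J a /\ w a = 0)) as [(a & Ja & Wa)|N].
{ left; intros x Jx.
  rewrite (Ew x), (linear_ode_zero J w c a x IJ Cc Hwc Ja Jx Wa); ring. }
right.
assert (Nw : forall x, J x -> w x <> 0) by (intros x Jx W; apply N; eauto).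
destruct (proj1 IJ) as (a & _ & Ja & _).
(* The first integral [B + 1/(2 w^2)] and the sign of [w], both constant along the solution, are
   read off at a base point [a]. *)
set (C := B (y a) + / (2 * w a ^ 2)).
set (s := if Rlt_dec 0 (w a) then true else false).
assert (HC : forall x, J x -> C = B (y x) + / (2 * w x ^ 2)).
{ intros x Jx.
  apply (antiderivative_on_zero_const J (fun x => B (y x) + / (2 * w x ^ 2)));
    trivial; clear x Jx; intros x Jx; specialize (Nw x Jx).
  assert (dB := is_derive_on_comp J I B y x _ _ Jx JI (HB _ (JI x Jx))
    (proj1 (Hy x Jx))).
  assert (W : 0 < w x ^ 2) by (apply pow2_gt_0; exact Nw).
  assert (dq : is_derive (fun z => / (2 * z ^ 2)) (w x) (- / w x ^ 3)).
  { auto_derive; [apply Rgt_not_eq; simpl in W |- *; lra|field; exact Nw]. }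
  assert (dw := is_derive_on_comp_is_derive J _ w x _ _ Jx dq (Hw x Jx)).
  eapply eq_rect; [exact (is_derive_on_plus _ _ _ _ _ _ Jx dB dw)|].
  field; exact Nw. }
assert (Hs : forall x, J x -> s = if Rlt_dec 0 (w x) then true else false).
{ intros x Jx; unfold s.
  destruct (continuous_on_constant_sign J w IJ Cw Nw) as [P|P];
    pose proof (P a Ja); pose proof (P x Jx);
    destruct (Rlt_dec 0 (w a)), (Rlt_dec 0 (w x)); trivial; lra. }
assert (HV : forall x, J x ->
  v_gen_domain I B C (y x) /\ v_gen g h A B s C (y x) = / y1 x).
{ intros x Jx; rewrite (Hs x Jx), (Ew x).
  destruct (v_gen_of_bernoulli g h A B C (y x) (w x) (Nw x Jx) (HC x Jx)).
  split; [split|]; auto. }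
(* The derivative of [x - Phi s C (y x)] is [1 - v y' = 0], so its value at [a] serves as [x0]. *)
exists s, C, (a - Phi s C (y a)); split; [exact Cy|].
intros x Jx; destruct (HV x Jx) as [Dx Vx], (Hy x Jx) as [_ N1].
split; [exact Dx|split].
{ rewrite Vx; now apply Rinv_neq_0_compat. }
enough (x + -1 * Phi s C (y x) = a + -1 * Phi s C (y a)) by lra.
apply (antiderivative_on_zero_const J (fun x => x + -1 * Phi s C (y x))); trivial.
clear x Jx Dx Vx N1; intros x Jx; destruct (HV x Jx) as [Dx Vx], (Hy x Jx) as [dy N1].
assert (dP := is_derive_on_comp J (v_gen_domain I B C) (Phi s C) y x _ _ Jx
  (fun t Jt => proj1 (HV t Jt)) (HPhi s C _ Dx) dy).
assert (dx := is_derive_on_of_is_derive J (fun t => t) x 1 Jx (is_derive_id x)).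
eapply eq_rect; [exact (is_derive_on_plus _ _ _ _ _ _ Jx dx
  (is_derive_on_scal _ _ (-1) _ _ Jx dP))|].
rewrite Vx; field; exact N1.
Qed.

(** * The general solution *)

Theorem theorem1 :
  forall (I : R -> Prop) (f g h k : R -> R) (A B : R -> R)
    (Phi : bool -> R -> R -> R),
  interval I ->
  smooth_on I f -> smooth_on I g -> smooth_on I h -> smooth_on I k ->
  (forall y, I y -> h y <> 0) ->
  abel_solution I f g h k (v_p0 g h) ->
  (forall y, I y ->
     is_derive_on I (fun z => g z / h z) y
       (- 3 * k y + f y * g y / h y - 2 / 9 * (g y ^ 3 / h y ^ 2))) ->
  antiderivative_on I (fun y => f y - g y ^ 2 / (3 * h y)) A ->
  antiderivative_on I (fun y => h y * exp (2 * A y)) B ->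
  (forall s C,
     antiderivative_on (v_gen_domain I B C) (v_gen g h A B s C) (Phi s C)) ->
  is_general_solution I f g h k A B Phi.
Proof.
intros I f g h k A B Phi _ _ _ (dh & Hh0 & Hh1) _ Hh Hp _ HA HB HPhi.
(* Continuity of [h] makes the coefficient of the linear equation for [w] continuous. *)
assert (Ch : continuous_on I h).
{ intros z Iz; apply is_derive_on_continuous with (dh 1%nat z); trivial.
  apply is_derive_on_ext with (dh 0%nat); trivial; now apply Hh1. }
assert (HV : forall s C,
  abel_solution (v_gen_domain I B C) f g h k (v_gen g h A B s C)).
{ intros s C; now apply v_gen_abel. }
assert (DI : forall C z, v_gen_domain I B C z -> I z) by (intros C z []; trivial).
split; [|split; [|split]].
- intros s C x0 J y IJ HJ.
  assert (dy := implicit_curve_derive I g h A B Phi s C x0 J y (HPhi s C) HJ).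
  split; [|exact dy].
  apply abel_solution_lienard with (v_gen_domain I B C) (v_gen g h A B s C); trivial; [apply DI|].
  intros x Jx; destruct (proj2 HJ x Jx) as (Dx & Vx & _); auto.
- intros s C x0 E IE HE.
  destruct (nonzero_derivative_inverse E (v_gen g h A B s C) (Phi s C) x0 IE)
    as (y & IJ & Cy & Hy & HyE).
  + intros z Ez; eapply is_derive_on_continuous; [exact Ez|].
    eapply is_derive_on_subset; [exact Ez|intros t Et; exact (proj1 (HE t Et))|].
    exact (HV s C z (proj1 (HE z Ez))).
  + apply antiderivative_on_sub with (v_gen_domain I B C); auto.
    intros z Ez; apply (HE z Ez).
  + intros z Ez; apply (HE z Ez).
  (* The domain of the branch is the image of [E] under [x0 + Phi s C]. *)
  + exists (fun x => exists z, E z /\ x = x0 + Phi s C z), y.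
    split; [exact IJ|split; [split; [exact Cy|]|exact HyE]].
    intros x Jx; destruct (Hy x Jx) as [Ex Px].
    split; [|split]; trivial; apply (HE _ Ex).
(* Both descriptions give [y' = 1/v] at a point [a], so uniqueness of the derivative equates the two
   values of [v]; once [s] and [C] agree, the relation at [a] gives [x0]. *)
- intros s C x0 s' C' x0' J y IJ H H'.
  destruct (proj1 IJ) as (a & _ & Ja & _).
  destruct (proj2 H a Ja) as (Da & Va & Pa), (proj2 H' a Ja) as (Da' & Va' & Pa').
  destruct (v_gen_injective g h A B s s' C C' (y a)) as [<- <-];
    [apply Da|apply Da'| |].
  + apply Rinv_eq_reg, (is_derive_on_unique J y a); trivial;
      eapply implicit_curve_derive; eauto.
  + repeat split; lra.
- intros J y y1 IJ HL Hy; eapply lienard_solution_implicit; eauto.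
Qed.
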